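(* Let $G$ and $H$ be nonbipartite graphs, and let $G\times H$ be their direct product. Then $$|E(H)||E(G)|+2\leq mc(G\times H)\leq 2|E(H)||E(G)|+1.$$ Moreover, the lower bound is sharp: there exist nonbipartite graphs $G$ and $H$ with $mc(G\times H)=|E(H)||E(G)|+2$.
   Context: All graphs are simple, finite and undirected; nontrivial means having at least two vertices. Let $F$ be a nontrivial connected graph. An edge-coloring of $F$ is any map from $E(F)$ to a set of colors (adjacent edges may receive the same color). A path is monochromatic if all its edges have the same color. An edge-coloring of $F$ is a monochromatic connection coloring ($MC$-coloring) if any two vertices of $F$ are joined by a monochromatic path. The monochromatic connection number $mc(F)$ is the maximum number of colors used in an $MC$-coloring of $F$; if $F$ is not connected, $mc(F)=0$. The direct product $G\times H$ has vertex set $V(G)\times V(H)$, and $(g,h)$, $(g',h')$ are adjacent if and only if $gg'\in E(G)$ and $hh'\in E(H)$.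
   Formalization: G and H are additionally assumed connected; if either is disconnected then G×H is disconnected, so mc(G×H)=0 and the lower bound fails (e.g. G two disjoint triangles, H a triangle). *)

(* Defs.v *)
From HB Require Import structures.
From mathcomp Require Import all_boot.
From mathcomp Require Import boolp.

Set Implicit Arguments.
Unset Strict Implicit.
Unset Printing Implicit Defensive.

Record sgraph := SGraph {
  vertex :> finType;
  adj : rel vertex;
  adj_sym : symmetric adj;
  adj_irr : irreflexive adj }.

Definition edges (F : sgraph) : {set {set F}} :=
  [set e | [exists x, exists y, adj x y && (e == [set x; y])]].

Definition edge (F : sgraph) : finType := {e : {set F} | e \in edges F}.

(* The path is x :: p, following the convention of [path]. *)
Definition is_path (F : sgraph) (x y : F) (p : seq F) : Prop :=
  [/\ path (@adj F) x p, last x p = y & uniq (x :: p)].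

Definition path_edges (F : sgraph) (x : F) (p : seq F) : seq {set F} :=
  pairmap (fun u v => [set u; v]) x p.

Definition connected (F : sgraph) : Prop :=
  forall x y : F, exists p, is_path x y p.

Definition bipartite (F : sgraph) : Prop :=
  exists A : {set F}, forall x y : F, adj x y -> (x \in A) != (y \in A).

Definition monochromatic (F : sgraph) (C : Type) (c : edge F -> C)
    (x : F) (p : seq F) : Prop :=
  forall e1 e2 : edge F,
    val e1 \in path_edges x p -> val e2 \in path_edges x p -> c e1 = c e2.

Definition MC_coloring (F : sgraph) (C : Type) (c : edge F -> C) : Prop :=
  forall x y : F, x != y -> exists2 p, is_path x y p & monochromatic c x p.

(* Only colors actually used are counted, not the whole palette C. *)
Definition ncolors (F : sgraph) (C : eqType) (c : edge F -> C) : nat :=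
  size (undup (codom c)).

Definition MC_colors (F : sgraph) (k : nat) : Prop :=
  exists (C : eqType) (c : edge F -> C), MC_coloring c /\ ncolors c = k.

(* No coloring uses more than #|edges F| colors, so the bounded maximum is the
   maximum over all MC-colorings; see [mc_upper] and [mc_attained]. *)
Definition mc (F : sgraph) : nat :=
  if `[< connected F >]
  then \max_(k < #|edges F|.+1 | `[< MC_colors F k >]) k
  else 0.

Lemma ncolors_le (F : sgraph) (C : eqType) (c : edge F -> C) :
  ncolors c <= #|edges F|.
Proof.
by rewrite /ncolors (leq_trans (size_undup _)) // size_codom card_sig.
Qed.

Lemma mc_upper (F : sgraph) (C : eqType) (c : edge F -> C) :
  connected F -> MC_coloring c -> ncolors c <= mc F.
Proof.
move=> /asboolP Fconn cMC; rewrite /mc Fconn.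
have cF : ncolors c < #|edges F|.+1 by rewrite ltnS ncolors_le.
apply: (@leq_bigmax_cond _ _ (@nat_of_ord _) (Ordinal cF)).
by apply/asboolP; exists C, c.
Qed.

Lemma mc_attained (F : sgraph) : connected F -> MC_colors F (mc F).
Proof.
move=> Fconn; rewrite /mc (asboolT Fconn).
have [c0 c0MC] : exists c : edge F -> unit, MC_coloring c.
  exists (fun=> tt) => x y _; have [p xyp] := Fconn x y.
  by exists p.
have c0F : ncolors c0 < #|edges F|.+1 by rewrite ltnS ncolors_le.
have c0P : `[< MC_colors F (Ordinal c0F) >] by apply/asboolP; exists unit, c0.
have [k /asboolP kP ->] := eq_bigmax_cond (@nat_of_ord _)
  (introT card_gt0P (ex_intro (fun k => k \in [pred k : 'I_#|edges F|.+1 | `[< MC_colors F k >]]) _ c0P)).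
exact: kP.
Qed.

Section DirectProduct.
Variables G H : sgraph.

Definition direct_adj : rel (G * H) :=
  fun u v => adj u.1 v.1 && adj u.2 v.2.

Lemma direct_adj_sym : symmetric direct_adj.
Proof. by move=> u v; rewrite /direct_adj adj_sym [in RHS]adj_sym (adj_sym u.2) adj_sym. Qed.

Lemma direct_adj_irr : irreflexive direct_adj.
Proof. by move=> u; rewrite /direct_adj adj_irr. Qed.

Definition direct_product : sgraph := SGraph direct_adj_sym direct_adj_irr.

End DirectProduct.

(* Main.v *)
(* Giving one color to a spanning tree and pairwise distinct colors to the other
   edges shows mc(F) >= |E(F)| - |F| + 2 for connected F. A connected nonbipartite
   graph has an edge outside any spanning tree, so |G| <= |E(G)|, |H| <= |E(H)|;
   with |E(G x H)| = 2 |E(G)| |E(H)| this gives the lower bound. G x H is connected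
   because any two vertices of G, and of H, are joined by an odd walk, which can be
   lengthened by any even number. The upper bound is just mc(F) <= |E(F)|.
   For sharpness, an MC-coloring of F uses at most |E(F)| - |F| + 2 colors as soon
   as two vertices of F have no common neighbor. The product of two paws has such
   vertices: fix one coordinate and, in the other, take the pendant vertex and its
   neighbor. *)

Require Import Defs.
From mathcomp Require Import all_boot.
From mathcomp Require Import boolp.
From mathcomp Require Import zify.

Set Implicit Arguments.
Unset Strict Implicit.
Unset Printing Implicit Defensive.

(** * Walks of prescribed length and breadth-first forests *)

Section Steps.
Variables (T : finType) (e : rel T).

(** The length is recorded because parity matters later; the target is a predicate so that distance
    to a set of roots is covered too. *)
Fixpoint steps (n : nat) (S : pred T) (v : T) : bool :=
  if n is m.+1 then [exists w, e v w && steps m S w] else S v.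

Lemma steps_cat m n S w v :
  steps m (pred1 w) v -> steps n S w -> steps (m + n) S v.
Proof.
elim: m v => [|m IHm] v /=; first by move=> /eqP->.
case/existsP=> u /andP[evu umw] wn.
by apply/existsP; exists u; rewrite evu IHm.
Qed.

Lemma steps_sym n v w :
  symmetric e -> steps n (pred1 w) v -> steps n (pred1 v) w.
Proof.
move=> eC; elim: n v => [|n IHn] v /=; first by rewrite eq_sym.
case/existsP=> u /andP[evu /IHn wu].
have uv : steps 1 (pred1 v) u by apply/existsP; exists v; rewrite eC evu /=.
by have := steps_cat wu uv; rewrite addn1.
Qed.

(** Go back and forth along the first edge, which exists since [0 < n]. *)
Lemma steps_pad k n v w :
  symmetric e -> 0 < n -> steps n (pred1 w) v -> steps (n + k.*2) (pred1 w) v.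
Proof.
move=> eC; case: n => // n _ vw; elim: k => [|k IHk]; first by rewrite addn0.
rewrite doubleS !addnS; case/existsP: vw => u /andP[evu _].
apply/existsP; exists u; rewrite evu; apply/existsP; exists v.
by rewrite eC evu.
Qed.

Lemma steps_connect n v w : steps n (pred1 w) v -> connect e v w.
Proof.
elim: n v => [|n IHn] v /=; first by move=> /eqP->.
by case/existsP=> u /andP[/connect1 evu /IHn]; apply: connect_trans.
Qed.

Lemma connect_steps (S : pred T) v s :
  S s -> connect e v s -> exists n, steps n S v.
Proof.
move=> Ss /connectP[p + ps]; rewrite {}ps in Ss.
elim: p v Ss => [|u p IHp] v /= Sv; first by exists 0.
case/andP=> evu /(IHp _ Sv)[n un].
by exists n.+1; apply/existsP; exists u; rewrite evu.
Qed.

(* [d] is the distance to [S], and [p] a parent function of a breadth-first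
   search forest rooted at [S]. *)
Lemma bfs_forest (S : pred T) :
  exists (d : T -> nat) (p : T -> T), forall v s,
    S s -> connect e v s -> ~~ S v -> e v (p v) /\ d v = (d (p v)).+1.
Proof.
have /choice[d dP] v : exists n, forall m, steps m S v ->
    steps n S v && (n <= m).
  have [vS|vS] := pselect (exists n, steps n S v).
    by exists (ex_minn vS) => m vm; case: ex_minnP => n -> /(_ _ vm).
  (* A default: no walk from [v] reaches [S], so the condition is void. *)
  by exists 0 => m vm; case: vS; exists m.
have /choice[p pP] v : exists w, forall s,
    S s -> connect e v s -> ~~ S v -> e v w /\ d v = (d w).+1.
  have [[n vn]|vS] := pselect (exists n, steps n S v); last first.
    by exists v => s Ss /(connect_steps Ss) /vS.
  have [Sv|nSv] := boolP (S v); first by exists v.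
  have /andP[+ _] := dP _ _ vn.
  case dv: (d v) => [|m] /=; first by rewrite (negPf nSv).
  case/existsP=> w /andP[evw /dP/andP[wd dw]].
  (* The second vertex of a shortest walk serves as parent: a shortest walk from [w], preceded by
     the edge from [v], shows [d v <= (d w).+1]. *)
  exists w => s _ _ _; split=> //; congr _.+1; apply/eqP.
  rewrite eqn_leq dw andbT -ltnS -dv.
  have /dP/andP[_] // : steps (d w).+1 S v.
  by apply/existsP; exists w; rewrite evw.
by exists d, p => v s; apply: pP.
Qed.

Lemma connect_first v w :
  connect e v w -> v != w -> exists2 u, e v u & connect e u w.
Proof.
case/connectP=> [[|u p]] /=; first by move=> _ ->; rewrite eqxx.
case/andP=> evu up wp _; exists u => //.
by apply/connectP; exists p.
Qed.

End Steps.

(** Otherwise [v] and [w] would be parents of each other, each one level deeper than the other. *)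
Lemma set2_parent_inj (T : finType) (d : T -> nat) (p : T -> T) v w :
  d v = (d (p v)).+1 -> d w = (d (p w)).+1 ->
  [set v; p v] = [set w; p w] -> v = w.
Proof.
move=> dv dw vw.
have : v \in [set w; p w] by rewrite -vw set21.
have : w \in [set v; p v] by rewrite vw set21.
rewrite !inE => /orP[/eqP//|/eqP wE] /orP[/eqP//|/eqP vE].
by move: dv dw; rewrite -wE -vE => ->; lia.
Qed.

(** * Edges, arcs and connectivity of a single graph *)

Section Graph.
Variable F : sgraph.
Implicit Types x y u v : F.

Lemma edgesP (e : {set F}) :
  reflect (exists x y, adj x y /\ e = [set x; y]) (e \in edges F).
Proof.
rewrite inE; apply: (iffP existsP) => [[x /existsP[y /andP[xy /eqP->]]]|].
  by exists x, y.
by case=> x [y [xy ->]]; exists x; apply/existsP; exists y; rewrite xy eqxx.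
Qed.

Lemma mem_edges x y : ([set x; y] \in edges F) = adj x y.
Proof.
apply/edgesP/idP => [[u [v [uv xyE]]]|xy]; last by exists x, y.
have: u \in [set x; y] by rewrite xyE set21.
have: v \in [set x; y] by rewrite xyE set22.
rewrite !inE => /orP[]/eqP vE /orP[]/eqP uE; move: uv; rewrite uE vE ?adj_irr //.
by rewrite adj_sym.
Qed.

(** Each edge is the image of exactly two arcs. Arcs are convenient because those of a direct
    product correspond to pairs of arcs of the factors. *)
Lemma card_arcs : #|[set a : F * F | adj a.1 a.2]| = 2 * #|edges F|.
Proof.
rewrite mulnC -sum_nat_const -sum1_card.
rewrite (partition_big (fun a => [set a.1; a.2]) (mem (edges F))) /=; last first.
  by case=> u v; rewrite inE mem_edges.
apply: eq_bigr => e /edgesP[x [y [xy ->]]].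
have xNy : x != y by apply: contraTneq xy => ->; rewrite adj_irr.
rewrite sum1_card -[RHS](_ : #|[set (x, y); (y, x)]| = 2); last first.
  by rewrite cards2 xpair_eqE (negPf xNy).
apply: eq_card => -[u v]; rewrite unfold_in inE !inE !xpair_eqE /=.
apply/andP/idP => [[uv /eqP uvE]|].
  have: u \in [set x; y] by rewrite -uvE set21.
  have: v \in [set x; y] by rewrite -uvE set22.
  rewrite !inE => /orP[]/eqP vE /orP[]/eqP uE; move: uv; rewrite uE vE ?adj_irr //.
    by rewrite !eqxx orbT.
  by rewrite !eqxx.
by case/orP=> /andP[/eqP-> /eqP->]; rewrite ?[adj y x]adj_sym xy ?eqxx // setUC.
Qed.

Lemma connectedP : connected F <-> forall x y, connect (@adj F) x y.
Proof.
split=> Fc x y; first by have [p [xp py _]] := Fc x y; apply/connectP; exists p.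
by have /connectP[p /shortenP[q xq uq _] ->] := Fc x y; exists q.
Qed.

(** * Spanning trees given by a depth and a parent function *)

Section Tree.
Variables (r : F) (d : F -> nat) (p : F -> F).
Hypothesis treeP : forall v, v != r -> adj v (p v) /\ d v = (d (p v)).+1.

Let T := [set [set v; p v] | v in [set~ r]].

Lemma tree_edges : T \subset edges F.
Proof.
by apply/subsetP=> _ /imsetP[v + ->]; rewrite in_setC1 mem_edges => /treeP[].
Qed.

Lemma card_tree : #|T|.+1 = #|F|.
Proof.
rewrite card_in_imset; first by rewrite cardsC1 prednK //; apply/card_gt0P; exists r.
move=> v w; rewrite !inE => /treeP[_ dv] /treeP[_ dw].
exact: (set2_parent_inj dv dw).
Qed.

Lemma tree_connect v w :
  connect (fun v w => [set v; w] \in T) v w.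
Proof.
have TC : connect_sym (fun v w => [set v; w] \in T).
  by apply: sym_connect_sym => {}v {}w; rewrite setUC.
suff rP u : connect (fun v w => [set v; w] \in T) u r.
  by apply: connect_trans (rP v) _; rewrite TC.
have [n] := ubnP (d u); elim: n u => // n IHn u.
have [->|ur] := eqVneq u r; first by rewrite connect0.
have [_ du] := treeP ur; rewrite ltnS => un.
apply: connect_trans (IHn (p u) _); last by rewrite -du.
by apply/connect1/imsetP; exists u; rewrite ?inE.
Qed.

Lemma tree_odd v w : [set v; w] \in T -> odd (d v) != odd (d w).
Proof.
case/imsetP=> u; rewrite !inE => /treeP[up du] vwE.
have uNp : u != p u by apply: contraTneq up => <-; rewrite adj_irr.
have := set21 u (p u); have := set22 u (p u); rewrite -vwE !inE.
case/orP=> /eqP pE /orP[]/eqP uE.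
- by rewrite {1}uE -pE eqxx in uNp.
- by rewrite -uE -pE du /=; case: odd.
- by rewrite -uE -pE du /=; case: odd.
- by rewrite {1}uE -pE eqxx in uNp.
Qed.

End Tree.

Lemma spanning_tree (r : F) : connected F ->
  exists (d : F -> nat) (p : F -> F),
    forall v, v != r -> adj v (p v) /\ d v = (d (p v)).+1.
Proof.
move=> /connectedP Fc; have [d [p dpP]] := bfs_forest (@adj F) (pred1 r).
by exists d, p => v vr; apply: (dpP v r) => //=.
Qed.

Lemma nonbipartite_inhabited : ~ bipartite F -> exists r : F, True.
Proof.
move=> Fb; have [r _|Fe] := pickP (@predT F); first by exists r.
by case: Fb; exists set0 => x; have := Fe x.
Qed.

(** If a spanning tree contained every edge, parity of depth would give a bipartition; so its
    [#|F| - 1] edges form a proper subset. *)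
Lemma nonbipartite_card_edges :
  connected F -> ~ bipartite F -> #|F| <= #|edges F|.
Proof.
move=> Fc Fb; have [r _] := nonbipartite_inhabited Fb.
have [d [p dpP]] := spanning_tree r Fc.
rewrite -(card_tree dpP); apply/proper_card/properP; split.
  exact: tree_edges dpP.
apply: contrapT => Tall; apply: Fb; exists [set v | odd (d v)] => x y xy.
rewrite !inE; apply: (tree_odd dpP); apply: contrapT => /negP xyT.
by apply: Tall; exists [set x; y]; rewrite ?mem_edges.
Qed.

Lemma mc_lower : connected F -> 1 < #|F| -> #|edges F| + 2 <= mc F + #|F|.
Proof.
move=> Fc F2; have [r _] : exists r : F, r \in F by apply/card_gt0P/ltnW.
have [d [p dpP]] := spanning_tree r Fc.
set T := [set [set v; p v] | v in [set~ r]].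
have cT : #|T|.+1 = #|F| := card_tree dpP.
have TE : T \subset edges F := tree_edges dpP.
(* [None] is the common color of the tree; every other edge is its own color. *)
pose c (e : edge F) := if val e \in T then None else Some e.
have cMC : MC_coloring c.
  move=> x y xy; have /connectP[q /shortenP[q' xq' uq' _] ->] := tree_connect dpP x y.
  exists q'.
    split=> //; apply: sub_path xq' => u v; rewrite -mem_edges.
    exact: (subsetP TE).
  have qT e : val e \in path_edges x q' -> c e = None.
    rewrite /c => eq; suff -> : val e \in T by [].
    move: xq' eq; elim: q' x {uq' xy} => //= u s IHs x /andP[xu us].
    by rewrite inE => /orP[/eqP->//|]; apply: IHs.
  by move=> e1 e2 /qT-> /qT->.
apply: leq_trans (leq_add (mc_upper Fc cMC) (leqnn _)).
(* Since [1 < #|F|], the tree has an edge, so the color [None] is really used. *)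
have [t tT] : exists t, t \in T by apply/card_gt0P; lia.
have tE := subsetP TE t tT.
pose L := None :: [seq Some e | e <- enum [pred e : edge F | val e \notin T]].
have sizeL : size L = (#|edges F| - #|T|).+1.
  rewrite /= size_map -cardE -(card_imset _ val_inj); congr _.+1.
  rewrite -[in RHS](setIidPr TE) -cardsD; apply: eq_card => e; rewrite inE.
  apply/imsetP/andP => [[e' + ->]|[eT eE]]; first by rewrite inE => ->; rewrite (valP e').
  by exists (Sub e eE : edge F); rewrite ?inE SubK.
have uL : uniq L.
  rewrite /= map_inj_uniq ?enum_uniq ?andbT; last by move=> ? ? [].
  by apply/mapP => -[].
have : size L <= ncolors c.
  apply: uniq_leq_size => // o; rewrite mem_undup inE => /orP[/eqP->|].
    by apply/codomP; exists (Sub t tE : edge F); rewrite /c SubK tT.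
  case/mapP=> e; rewrite mem_enum inE => eT ->.
  by apply/codomP; exists e; rewrite /c (negPf eT).
by have := subset_leq_card TE; lia.
Qed.

(** * Color classes as relations on vertices *)

Section ColorClasses.
Variables (C : eqType) (c : edge F -> C).

Definition color_adj (k : C) : rel F := fun u v =>
  [exists e : edge F, (val e == [set u; v]) && (c e == k)].

Lemma color_adjP k u v :
  reflect (exists2 e : edge F, val e = [set u; v] & c e = k) (color_adj k u v).
Proof.
apply: (iffP existsP) => [[e /andP[/eqP ? /eqP ?]]|[e /eqP eE /eqP ck]].
  by exists e.
by exists e; rewrite eE.
Qed.

Lemma color_adj_adj k u v : color_adj k u v -> adj u v.
Proof. by case/color_adjP=> e eE _; rewrite -mem_edges -eE (valP e). Qed.

Lemma color_adj_sym k : symmetric (color_adj k).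
Proof. by move=> u v; apply: eq_existsb => e; rewrite setUC. Qed.

Lemma color_adj_eq k l u v u' v' :
  color_adj k u v -> color_adj l u' v' -> [set u; v] = [set u'; v'] -> k = l.
Proof.
by case/color_adjP=> e eE <- /color_adjP[f fE <-] E; congr c; apply: val_inj; rewrite eE fE.
Qed.

(** The color is that of the first edge of a monochromatic path, nonempty because [x != y]. *)
Lemma MC_color_connect x y :
  MC_coloring c -> x != y -> exists k, connect (color_adj k) x y.
Proof.
move=> cMC xy; have [p [xp py _] pm] := cMC x y xy.
case: p xp py pm => [|u p] xp py pm; first by rewrite -py eqxx in xy.
have xuE : [set x; u] \in edges F by rewrite mem_edges; case/andP: xp.
pose e0 : edge F := Sub [set x; u] xuE; exists (c e0); apply/connectP; exists (u :: p) => //.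
have pk e : val e \in path_edges x (u :: p) -> c e = c e0.
  by move=> ep; apply: pm => //; rewrite SubK inE eqxx.
move: (c e0) pk; clear -xp => k.
elim: {u p}(u :: p) x xp => //= u p IHp x /andP[xu up] pk.
have xuE : [set x; u] \in edges F by rewrite mem_edges.
rewrite IHp ?andbT // => [|e ep]; last by apply: pk; rewrite inE ep orbT.
by apply/color_adjP; exists (Sub [set x; u] xuE); rewrite ?pk // ?SubK ?inE ?eqxx.
Qed.

End ColorClasses.

(* Each [v] outside [{x, y}] picks a color [k v] joining it to [x], or to [y] if
   [v] is adjacent to [x], and is charged to the edge from [v] to its parent in
   the [k v]-colored forest rooted at [x] and [y] (at [x] only if [x] and [y]
   lie in the same component). Every color keeps an uncharged edge: the one
   from [y] to its parent in the second case, and otherwise an edge at the root,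
   since [x] and [y] have no common neighbor. *)
Lemma MC_ncolors_upper (C : eqType) (c : edge F -> C) x y :
  MC_coloring c -> x != y -> (forall v, ~~ (adj v x && adj v y)) ->
  ncolors c + #|F| <= #|edges F| + 2.
Proof.
move=> cMC xy noc.
have cC k : connect_sym (color_adj c k).
  by apply: sym_connect_sym; apply: color_adj_sym.
pose S k := [pred z | (z == x) || (z == y) && ~~ connect (color_adj c k) y x].
have /choice[d /choice[p dpP]] k := bfs_forest (color_adj c k) (S k).
pose D := ~: [set x; y].
have /choice[k kP] v : exists k, v \in D ->
    connect (color_adj c k) v (if adj v x then y else x).
  have [|_] := boolP (v \in D); last first.
    by have [k _] := MC_color_connect cMC xy; exists k.
  rewrite !inE negb_or => /andP[vx vy].
  have vr : v != if adj v x then y else x by case: ifP.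
  by have [k kP] := MC_color_connect cMC vr; exists k.
pose good l v := ~~ S l v /\ exists2 s, S l s & connect (color_adj c l) v s.
have goodP l v : good l v -> color_adj c l v (p l v) /\ d l v = (d l (p l v)).+1.
  by case=> vS [s Ss vs]; apply: dpP vs vS.
(* An edge has a single color, and within the forest of that color it determines its child end.
   Charging is therefore injective, even across colors. *)
have good_inj l l' v v' : good l v -> good l' v' ->
    [set v; p l v] = [set v'; p l' v'] -> v = v' /\ l = l'.
  move=> /goodP[vl dv] /goodP[vl' dv'] E.
  have ll' := color_adj_eq vl vl' E; rewrite -{}ll' in dv' E *.
  by split=> //; apply: (set2_parent_inj dv dv' E).
have Dgood v : v \in D -> good (k v) v.
  move=> vD; have := kP v vD; move: vD; rewrite /good !inE negb_or => /andP[/negPf vx /negPf vy] vk.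
  rewrite /= vx vy; split=> //.
  have [yx|yx] := boolP (connect (color_adj c (k v)) y x).
    exists x; rewrite /= ?eqxx //; case: ifP vk => // _ vy'.
    exact: connect_trans vy' yx.
  by exists (if adj v x then y else x) => //; case: ifP; rewrite /= ?yx !eqxx ?orbT.
pose J := [set [set v; p (k v) v] | v in D].
have JE : J \subset edges F.
  apply/subsetP=> _ /imsetP[v /Dgood/goodP[/color_adj_adj vp _] ->].
  by rewrite mem_edges.
have cJ : #|J| + 2 = #|F|.
  rewrite card_in_imset; first by rewrite addnC -(cardsC [set x; y]) cards2 xy.
  by move=> v w /Dgood vg /Dgood wg /(good_inj _ _ _ _ vg wg)[].
have missed e : exists2 f : edge F, val f \notin J & c f = c e.
  set l := c e.
  have [yx|yx] := boolP (connect (color_adj c l) y x).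
    have yg : good l y.
      by split; [rewrite /= yx andbF orbF eq_sym | exists x; rewrite /= ?eqxx].
    have [/color_adjP[f fE fl] _] := goodP _ _ yg; exists f => //.
    apply/imsetP=> -[v vD]; rewrite fE => /(good_inj _ _ _ _ yg (Dgood v vD))[yv _].
    by move: vD; rewrite -yv !inE eqxx orbT.
  (* If [e] is charged, its charger [v] has picked the color [l] and is joined in it to the root
     [r]; the candidate is then the first edge, from [r] to [u], of such a connection. *)
  have [/imsetP[v vD eE]|eJ] := boolP (val e \in J); last by exists e.
  have kD w : w \in D -> forall f : edge F, val f = [set w; p (k w) w] -> k w = c f.
    move=> /Dgood/goodP[/color_adjP[g gE gk] _] f fE.
    by rewrite -gk; congr c; apply: val_inj; rewrite gE fE.
  have vl : k v = l by exact: (kD v vD e eE).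
  have := kP v vD; rewrite {}vl; set r := (if _ then _ else _) => vr.
  have rD : r \notin D by rewrite /r !inE; case: ifP; rewrite eqxx ?orbT.
  have rv : r != v by apply: contraNneq rD => ->.
  rewrite cC in vr; have [u ru _] := connect_first vr rv.
  have [f fE fl] := color_adjP _ _ _ _ ru; exists f => //.
  apply/imsetP=> -[w wD wE].
  have wu : w = u.
    have : w \in [set r; u] by rewrite -fE wE set21.
    by rewrite !inE => /orP[]/eqP // wr; rewrite wr (negPf rD) in wD.
  have := kP w wD; rewrite (kD w wD f wE) fl wu => uk.
  have {uk} := connect_trans (connect1 ru) uk.
  have := color_adj_adj ru; rewrite adj_sym => ur.
  (* If that edge were charged, then by [u], which also reaches its own target in color [l]. A
     target other than [r] would join [x] to [y] in color [l]. If the target is [r], either [u] is a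
     common neighbor of [x] and [y], or it is adjacent to [x] and should have targeted [y]. *)
  case: (ifP (adj u x)) => ux; move: ur; rewrite /r; case: ifP => vx ur.
  - by have := noc u; rewrite ux ur.
  - by rewrite cC (negPf yx).
  - by rewrite (negPf yx).
  - by rewrite ur in ux.
have : ncolors c <= #|edges F :\: J|.
  have -> : #|edges F :\: J| = #|[pred e : edge F | val e \notin J]|.
    rewrite -[RHS](card_imset _ val_inj); apply: eq_card => e; rewrite in_setD.
    apply/andP/imsetP => [[eJ eE]|[e' + ->]]; last by rewrite inE => ->; rewrite (valP e').
    by exists (Sub e eE : edge F); rewrite ?inE SubK.
  rewrite cardE -(size_map c); apply: uniq_leq_size; first exact: undup_uniq.
  move=> l; rewrite mem_undup => /codomP[e ->].
  by have [f fJ <-] := missed e; apply: map_f; rewrite mem_enum inE.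
rewrite cardsD (setIidPr JE) -cJ addnA leq_add2r => cle.
by apply: leq_trans (leq_add cle (leqnn _)) _; rewrite subnK ?subset_leq_card.
Qed.

(** Without an odd closed walk at [x], the ends of even walks from [x] would form one side of a
    bipartition. Prepending such a closed walk corrects the parity of any walk from [x] to [y]. *)
Lemma odd_steps x y : connected F -> ~ bipartite F ->
  exists2 n, odd n & steps (@adj F) n (pred1 y) x.
Proof.
move=> /connectedP Fc Fb.
have walk u v : exists n, steps (@adj F) n (pred1 v) u.
  by apply: connect_steps (Fc u v) => /=.
have [n nodd xx] : exists2 n, odd n & steps (@adj F) n (pred1 x) x.
  apply: contrapT => noodd; apply: Fb.
  exists [set v | `[< exists2 n, ~~ odd n & steps (@adj F) n (pred1 v) x >]] => u v uv.
  rewrite !inE; apply/negP=> /eqP uvE.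
  have sadj := @adj_sym F.
  have uv1 : steps (@adj F) 1 (pred1 v) u by apply/existsP; exists v; rewrite uv /=.
  have noodd' m n : odd m = odd n -> steps (@adj F) m (pred1 u) x ->
      ~ steps (@adj F) n (pred1 v) x.
    move=> mn xu /(steps_sym sadj) vx; apply: noodd.
    exists (m + (1 + n)); first by rewrite !oddD /= mn; case: odd.
    by apply: steps_cat xu _; apply: steps_cat uv1 vx.
  have [m xm] := walk x u; have [n xn] := walk x v.
  have [mn|mn] := eqVneq (odd m) (odd n); first exact: noodd' mn xm xn.
  (* The parities differ, but [u] and [v] lie on the same side, so the one reached by an odd walk is
     also reached by an even one. *)
  have [mo|mo] := boolP (odd m).
    have [] := boolP (odd n) => no; first by rewrite mo no in mn.
    have /asboolP[m' m'o xm'] : `[< exists2 n, ~~ odd n & steps (@adj F) n (pred1 u) x >].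
      by rewrite uvE; apply/asboolP; exists n.
    by apply: noodd' xm' xn; rewrite (negPf m'o) (negPf no).
  have /asboolP[n' n'o xn'] : `[< exists2 n, ~~ odd n & steps (@adj F) n (pred1 v) x >].
    by rewrite -uvE; apply/asboolP; exists m.
  by apply: noodd' xm xn'; rewrite (negPf n'o) (negPf mo).
have [m xy] := walk x y; have [mo|mo] := boolP (odd m); first by exists m.
exists (n + m); first by rewrite oddD nodd (negPf mo).
exact: steps_cat xx xy.
Qed.

End Graph.

(** * Size and connectedness of the direct product *)

Section Product.
Variables G H : sgraph.

Lemma card_edges_product :
  #|edges (direct_product G H)| = 2 * #|edges H| * #|edges G|.
Proof.
suff : #|[set a : direct_product G H * direct_product G H | adj a.1 a.2]|
    = #|[set a : G * G | adj a.1 a.2]| * #|[set a : H * H | adj a.1 a.2]|.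
  by rewrite !card_arcs; nia.
rewrite -cardsX.
pose f (a : (G * H) * (G * H)) := ((a.1.1, a.2.1), (a.1.2, a.2.2)).
have fI : injective f by move=> [[? ?] [? ?]] [[? ?] [? ?]] [-> -> -> ->].
rewrite -[LHS](card_imset _ fI); apply: eq_card => -[[g g'] [h h']].
rewrite !inE /=; apply/imsetP/idP => [[[[? ?] [? ?]]]|gh].
  by rewrite inE => ? [-> -> -> ->].
by exists ((g, h), (g', h')); rewrite ?inE.
Qed.

Lemma steps_product n (g g' : G) (h h' : H) :
  steps (@adj G) n (pred1 g') g -> steps (@adj H) n (pred1 h') h ->
  steps (@adj (direct_product G H)) n (pred1 (g', h')) (g, h).
Proof.
elim: n g h => [|n IHn] g h /=; first by move=> /eqP-> /eqP->.
case/existsP=> u /andP[gu ug'] /existsP[v /andP[hv vh']].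
by apply/existsP; exists (u, v); rewrite IHn // andbT /direct_adj /= gu.
Qed.

Lemma connected_product :
  connected G -> connected H -> ~ bipartite G -> ~ bipartite H ->
  connected (direct_product G H).
Proof.
move=> Gc Hc Gb Hb; apply/connectedP=> -[g h] [g' h'].
have [m mo gm] := odd_steps g g' Gc Gb; have [n no hn] := odd_steps h h' Hc Hb.
have m0 : 0 < m by case: m mo {gm}.
have n0 : 0 < n by case: n no {hn}.
(* As [m] and [n] are odd, both sides equal [m + n - 1], a common length for the two walks. *)
have mn : m + (n./2).*2 = n + (m./2).*2.
  by have := odd_double_half m; have := odd_double_half n; rewrite mo no; lia.
apply: (@steps_connect _ _ (m + (n./2).*2)); apply: steps_product.
  by apply: steps_pad => //; apply: adj_sym.
by rewrite mn; apply: steps_pad => //; apply: adj_sym.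
Qed.

End Product.

Lemma nonbipartite_card (F : sgraph) : ~ bipartite F -> 1 < #|F|.
Proof.
move=> Fb; rewrite ltnNge; apply/negP => F1; apply: Fb; exists set0 => x y.
by rewrite (fintype_le1P F1 x y) adj_irr.
Qed.

(** * The paw, used for sharpness *)

Definition paw_adj (i j : 'I_4) : bool :=
  (i != j) && ((i < 3) && (j < 3) || (i + j == 3)).

Lemma paw_adj_sym : symmetric paw_adj.
Proof. by move=> i j; rewrite /paw_adj eq_sym addnC andbC andbC [(i < 3) && _]andbC. Qed.

Lemma paw_adj_irr : irreflexive paw_adj.
Proof. by move=> i; rewrite /paw_adj eqxx. Qed.

(* The triangle [0, 1, 2] with the pendant edge [{0, 3}]. *)
Definition paw : sgraph := SGraph paw_adj_sym paw_adj_irr.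

Lemma paw_connected : connected paw.
Proof.
apply/connectedP.
suff r0 (i : paw) : connect (@adj paw) (ord0 : 'I_4) i.
  move=> i j; apply: connect_trans (r0 j).
  by rewrite (sym_connect_sym (@adj_sym paw)).
have [->|i0] := eqVneq i (ord0 : 'I_4); first exact: connect0.
by apply: connect1; case: i i0 => [[|[|[|[|]]]]].
Qed.

(** The triangle would need three pairwise distinct booleans. *)
Lemma paw_nonbipartite : ~ bipartite paw.
Proof.
case=> A Abip.
have := Abip (inord 0 : 'I_4) (inord 1 : 'I_4).
have := Abip (inord 1 : 'I_4) (inord 2 : 'I_4).
have := Abip (inord 0 : 'I_4) (inord 2 : 'I_4).
rewrite /= /paw_adj -!(inj_eq val_inj) /= !inordK // => /(_ isT) + /(_ isT) + /(_ isT).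
by do 3 case: (_ \in A).
Qed.

Lemma card_edges_paw : #|edges paw| = 4.
Proof.
have : 2 * #|edges paw| = 8; last by lia.
rewrite -card_arcs -sum1_card big_mkcond /=.
rewrite (eq_bigr (fun a : 'I_4 * 'I_4 => nat_of_bool (paw_adj a.1 a.2))); last first.
  by case=> i j _; rewrite inE /=; case: paw_adj.
rewrite -(pair_bigA _ (fun i j => nat_of_bool (paw_adj i j))) /=.
by rewrite !big_ord_recl !big_ord0.
Qed.

Theorem theorem5 :
  (forall G H : sgraph,
     connected G -> connected H -> ~ bipartite G -> ~ bipartite H ->
     #|edges H| * #|edges G| + 2 <= mc (direct_product G H)
       <= 2 * #|edges H| * #|edges G| + 1)
  /\
  (exists G H : sgraph,
     [/\ connected G, connected H, ~ bipartite G, ~ bipartite H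
       & mc (direct_product G H) = #|edges H| * #|edges G| + 2]).
Proof.
have bounds (G H : sgraph) :
     connected G -> connected H -> ~ bipartite G -> ~ bipartite H ->
     #|edges H| * #|edges G| + 2 <= mc (direct_product G H)
       <= 2 * #|edges H| * #|edges G| + 1.
  move=> Gc Hc Gb Hb; have GHc := connected_product Gc Hc Gb Hb.
  have GHcard : #|direct_product G H| = #|G| * #|H| by rewrite card_prod.
  have eG := nonbipartite_card_edges Gc Gb.
  have eH := nonbipartite_card_edges Hc Hb.
  have G2 := nonbipartite_card Gb; have H2 := nonbipartite_card Hb.
  have GH2 : 1 < #|direct_product G H| by rewrite GHcard; nia.
  apply/andP; split.
    have := mc_lower GHc GH2; rewrite card_edges_product GHcard; nia.
  have [C [c [_ <-]]] := mc_attained GHc.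
  by have := ncolors_le c; rewrite card_edges_product; lia.
split=> //; exists paw, paw.
have Pc := paw_connected; have Pb := paw_nonbipartite.
split=> //; have /andP[lower _] := bounds _ _ Pc Pc Pb Pb.
apply/eqP; rewrite eqn_leq lower andbT.
have PPc := connected_product Pc Pc Pb Pb.
have [C [c [cMC <-]]] := mc_attained PPc.
pose x : direct_product paw paw := (@Ordinal 4 0 isT, @Ordinal 4 0 isT).
pose y : direct_product paw paw := (@Ordinal 4 3 isT, @Ordinal 4 0 isT).
(* First coordinates suffice: the only neighbor of 3 is 0, which is not adjacent to itself. *)
have noc v : ~~ (adj v x && adj v y).
  case: v => i j; rewrite /= /direct_adj /=.
  by case: i => [[|[|[|[|]]]]] //= ?; rewrite ?andbF.
have := MC_ncolors_upper cMC (isT : x != y) noc.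
(* With 32 edges and 16 vertices the bound is 32 - 16 + 2 = 18 = 4 * 4 + 2. *)
by rewrite card_edges_product card_prod !card_ord card_edges_paw; lia.
Qed.
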